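(* Let $(S,\cdot)$ be an inverse semigroup. Let $\mathbb{WB}^\circ$ be the set of all weak left braces $(S,+,\cdot)$ with the given multiplication $\cdot$, and let $\mathbb{AS}$ be the set of all affine structures $\diamond$ on $(S,\cdot)$. For $(S,+,\cdot)\in\mathbb{WB}^\circ$ let $\mathcal{A}(S)$ be the operation $\diamond$ given by $a\diamond b=-a^{-1}+a^{-1}b=a^{-1}(a+b)$, and for $\diamond\in\mathbb{AS}$ let $\mathcal{B}(\diamond)=(S,+,\cdot)$ where $x+y=x(x\diamond y)$. Then $\mathcal{A}:\mathbb{WB}^\circ\to\mathbb{AS}$ and $\mathcal{B}:\mathbb{AS}\to\mathbb{WB}^\circ$ are (well-defined) mutually inverse bijections.
   Context: A semigroup $(S,+)$ (not necessarily commutative) is an inverse semigroup if for each $a\in S$ there is a unique element $-a$ with $a-a+a=a$ and $-a+a-a=-a$; for an inverse semigroup $(S,\cdot)$ written multiplicatively this element is written $a^{-1}$. $E(S,\cdot)$ is the set of idempotents. Juxtaposition denotes $\cdot$. A weak left brace is a triple $(S,+,\cdot)$ with $(S,+)$ and $(S,\cdot)$ inverse semigroups such that $x(y+z)=xy-x+xz$ and $xx^{-1}=-x+x$ for all $x,y,z\in S$. A binary operation $\diamond$ on an inverse semigroup $(S,\cdot)$ is an affine structure on $(S,\cdot)$ if for all $a,b,c\in S$ and $e\in E(S,\cdot)$: (A1) $(ab)\diamond c=b\diamond(a\diamond c)$; (A2) $a\diamond(b(b\diamond c))=(a\diamond b)((a\diamond b)\diamond(a\diamond c))$; (A3) $e\diamond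 a=ea$ and $a\diamond e=a^{-1}ea$. *)

(* Defs.v *)
From mathcomp Require Import all_boot.
From mathcomp Require Import boolp classical_sets.

Set Implicit Arguments.
Unset Strict Implicit.
Unset Printing Implicit Defensive.

Local Open Scope classical_set_scope.

Definition is_inverse (S : Type) (op : S -> S -> S) (a b : S) : Prop :=
  op (op a b) a = a /\ op (op b a) b = b.

Definition inverse_semigroup (S : Type) (op : S -> S -> S) : Prop :=
  associative op /\ forall a : S, exists! b : S, is_inverse op a b.

(* The value is meaningful only when [op] is an inverse semigroup, see
   [sinvP]; [{classic S}] is [S] with a classical choice structure, as needed
   by [xget]. *)
Definition sinv (S : Type) (op : S -> S -> S) (a : S) : S :=
  xget (a : {classic S}) [set b | is_inverse op a b].

Lemma sinvP (S : Type) (op : S -> S -> S) (a : S) :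
  inverse_semigroup op -> is_inverse op a (sinv op a).
Proof.
move=> [_ /(_ a) [b [hb _]]].
exact: (@xgetPex {classic S} a [set b | is_inverse op a b] (ex_intro _ b hb)).
Qed.

Definition idempotents (S : Type) (op : S -> S -> S) : set S :=
  [set e | op e e = e].

Definition weak_left_brace (S : Type) (add mul : S -> S -> S) : Prop :=
  let neg := sinv add in
  let inv := sinv mul in
  [/\ inverse_semigroup add,
      inverse_semigroup mul,
      forall x y z : S,
        mul x (add y z) = add (add (mul x y) (neg x)) (mul x z)
    & forall x : S, mul x (inv x) = add (neg x) x].

Definition affine_structure (S : Type) (mul dia : S -> S -> S) : Prop :=
  let inv := sinv mul in
  [/\ forall a b c : S, dia (mul a b) c = dia b (dia a c),
      forall a b c : S,
        dia a (mul b (dia b c)) = mul (dia a b) (dia (dia a b) (dia a c)),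
      forall e a : S, idempotents mul e -> dia e a = mul e a
    & forall e a : S, idempotents mul e -> dia a e = mul (mul (inv a) e) a].

(* A brace (S, +, .) with prescribed multiplication is identified with its
   addition. *)
Definition WB (S : Type) (mul : S -> S -> S) : set (S -> S -> S) :=
  [set add | weak_left_brace add mul].

Definition AS (S : Type) (mul : S -> S -> S) : set (S -> S -> S) :=
  [set dia | affine_structure mul dia].

Definition affine_of_brace (S : Type) (mul add : S -> S -> S) : S -> S -> S :=
  fun a b => add (sinv add (sinv mul a)) (mul (sinv mul a) b).

Definition brace_of_affine (S : Type) (mul dia : S -> S -> S) : S -> S -> S :=
  fun x y => mul x (dia x y).

(* Main.v *)
(** For a weak left brace, [e x = e + x = x + e] for every idempotent [e], so
    [(S, +)] is Clifford, and the maps [y |-> - x + x y] form an action of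
    [(S, .)] by endomorphisms of [(S, +)]; the affine structure is this action
    composed with inversion.  Conversely, an affine structure gives
    [x y = x + (x^-1 <+> y)] for [x + y := x (x <+> y)], and then
    [- x = x^-1 <+> x^-1]. *)
Require Import Defs.
From mathcomp Require Import all_boot.
From mathcomp Require Import boolp classical_sets functions.

Set Implicit Arguments.
Unset Strict Implicit.
Unset Printing Implicit Defensive.

(** * Inverse semigroups and their commuting idempotents *)

Section InverseSemigroup.
Variables (S : Type) (op : S -> S -> S).
Hypothesis opP : inverse_semigroup op.
Local Infix "*" := op.
Local Notation inv := (sinv op).

Lemma isgA : associative op. Proof. by case: opP. Qed.

Lemma isgKr a : a * inv a * a = a. Proof. by case: (sinvP a opP). Qed.

Lemma isgKl a : inv a * a * inv a = inv a. Proof. by case: (sinvP a opP). Qed.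

Lemma is_inverse_sinv a b : is_inverse op a b -> sinv op a = b.
Proof.
move=> ab; case: opP => _ /(_ a) [c [_ c_uniq]].
by rewrite -(c_uniq _ (sinvP a opP)) -(c_uniq _ ab).
Qed.

Lemma sinvK a : inv (inv a) = a.
Proof. by apply: is_inverse_sinv; split; rewrite ?isgKl ?isgKr. Qed.

Lemma sinv_idem e : idempotents op e -> inv e = e.
Proof. by move=> ee; apply: is_inverse_sinv; split; rewrite !ee. Qed.

Lemma idem_mulV a : idempotents op (a * inv a).
Proof. by rewrite /idempotents /= isgA isgKr. Qed.

Lemma idem_mulVl a : idempotents op (inv a * a).
Proof. by rewrite /idempotents /= isgA isgKl. Qed.

(** With [x] the inverse of [e * f], the element [f * x * e] is an inverse too, so [x = f * x * e].
    This makes [x] idempotent, hence its own inverse, so [e * f = x]. *)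
Lemma idem_mul e f :
  idempotents op e -> idempotents op f -> idempotents op (e * f).
Proof.
rewrite /idempotents /= => ee ff; set x := inv (e * f).
have xE : x * e * f * x = x by rewrite -(isgA x) isgKl.
have fxe : x = f * x * e.
  apply: is_inverse_sinv; split; rewrite !isgA.
    by rewrite -(isgA e f f) ff -(isgA _ e e) ee -(isgA (e * f * x)) isgKr.
  rewrite -(isgA _ e e) ee -(isgA _ f f) ff.
  by rewrite -[in RHS]xE !isgA.
have xx : x * x = x.
  have -> : x * x = f * (x * e * f * x) * e by rewrite {1 2}fxe !isgA.
  by rewrite xE -fxe.
by rewrite -[e * f]sinvK -/x (sinv_idem xx).
Qed.

(** Both products are idempotent, so [f * e] is an inverse of [e * f], which is already its own
    inverse. *)
Lemma idemC e f : idempotents op e -> idempotents op f -> e * f = f * e.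
Proof.
move=> ee ff; have := idem_mul ee ff; have := idem_mul ff ee.
move: ee ff; rewrite /idempotents /= => ee ff fefe efef.
rewrite -[LHS](sinv_idem efef).
apply: is_inverse_sinv; split; rewrite !isgA.
  by rewrite -(isgA e f f) ff -(isgA _ e e) ee -(isgA (e * f)).
by rewrite -(isgA f e e) ee -(isgA _ f f) ff -(isgA (f * e)).
Qed.

Lemma sinvM a b : inv (a * b) = inv b * inv a.
Proof.
have C := idemC (idem_mulV b) (idem_mulVl a).
apply: is_inverse_sinv; split; rewrite !isgA.
  rewrite -(isgA a b) -(isgA _ (inv a) a) -(isgA a) C.
  by rewrite !isgA isgKr -!(isgA a) isgKr.
rewrite -(isgA (inv b)) -(isgA _ b (inv b)) -(isgA (inv b)) -C.
by rewrite !isgA isgKl -!(isgA (inv b)) isgKl.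
Qed.

Lemma idem_absorb e a : e * (a * inv a) = a * inv a -> e * a = a.
Proof. by move=> eE; rewrite -{1}(isgKr a) isgA eE isgKr. Qed.

Lemma sinv_morph (f : S -> S) a :
  (forall x y, f (x * y) = f x * f y) -> f (inv a) = inv (f a).
Proof.
move=> fM; apply/esym/is_inverse_sinv.
by split; rewrite -!fM ?isgKl ?isgKr.
Qed.

End InverseSemigroup.

(** If [b] and [c] are inverses of [a], commuting idempotents give [b a = c a] and [a b = a c],
    whence [b = b a b = c a c = c]. *)
Lemma inverse_semigroup_of_idemC (S : Type) (op : S -> S -> S) :
  associative op -> (forall a, exists b, is_inverse op a b) ->
  (forall e f, idempotents op e -> idempotents op f -> op e f = op f e) ->
  inverse_semigroup op.
Proof.
move=> A reg C; split=> // a; have [b ab] := reg a; exists b; split=> // c ac.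
case: ab ac => aba bab [aca cac].
have idl x y : op (op x y) x = x -> idempotents op (op x y).
  by rewrite /idempotents /= A => ->.
have E1 : op b a = op c a.
  rewrite -{1}aca 2!A -A C; [|exact: idl..].
  by rewrite -A (A a) aba.
have E2 : op a b = op a c.
  rewrite -{1}aca -(A _ a b) C; [|exact: idl..].
  by rewrite A aba.
by rewrite -bab E1 -A E2 A.
Qed.

(** * From a weak left brace to an affine structure *)

Section AffineOfBrace.
Variables (S : Type) (add mul : S -> S -> S).
Hypothesis brace : weak_left_brace add mul.
Local Infix "+" := add.
Local Infix "*" := mul.
Local Notation "- x" := (sinv add x).
Local Notation inv := (sinv mul).

Let addP : inverse_semigroup add. Proof. by case: brace. Qed.
Let mulP : inverse_semigroup mul. Proof. by case: brace. Qed.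
Let addA := isgA addP.
Let mulA := isgA mulP.

Lemma brace_distr x y z : x * (y + z) = x * y + - x + x * z.
Proof. by case: brace. Qed.

Lemma brace_mulV x : x * inv x = - x + x. Proof. by case: brace. Qed.

Lemma brace_idem e : idempotents add e <-> idempotents mul e.
Proof.
split=> ee; have := brace_mulV e; rewrite (sinv_idem _ ee) // ee => eE.
  by rewrite -eE; exact: idem_mulV.
by rewrite eE; exact: idem_mulVl.
Qed.

(** Distributivity gives [e * (e + f) = e * f]; it also gives [(e + f) * e = e + f], and these
    idempotents commute. *)
Lemma brace_mul_idem e f :
  idempotents mul e -> idempotents mul f -> e * f = e + f.
Proof.
move=> ee ff; have ef := idem_mul mulP ee ff.
have /brace_idem Aee := ee; have /brace_idem Aff := ff.
have /brace_idem Aef := ef.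
have /brace_idem gg := idem_mul addP Aee Aff.
have absorb g h : idempotents mul g -> idempotents mul h -> g + g * h = g * h.
  move=> Hg Hh; have /brace_idem Ag := Hg; have /brace_idem Ah := Hh.
  have /brace_idem Agh := idem_mul mulP Hg Hh.
  have := brace_distr g h h; rewrite Ah (sinv_idem addP Ag).
  by rewrite (idemC addP Agh Ag) -addA Agh.
have E : e * (e + f) = e * f.
  by rewrite brace_distr (sinv_idem addP Aee) ee Aee absorb.
have E' : (e + f) * e = e + f.
  have := brace_distr (e + f) (e + f) e.
  rewrite (sinv_idem addP (idem_mul addP Aee Aff)) gg.
  have -> : e + f + e = e + f by rewrite (idemC addP Aee Aff) -addA Aee.
  by rewrite gg (idem_mul addP Aee Aff) absorb // => <-.
by rewrite -E (idemC mulP ee gg) E'.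
Qed.

(** Left multiplication by [e] fixes [x + e], because [e] absorbs [- (x + e) + (x + e)].
    Distributing then gives [e * x + e], whose last term disappears into [- (e * x) + e * x]. *)
Lemma brace_addr_idem e x : idempotents mul e -> x + e = e * x.
Proof.
move=> ee; have /brace_idem Aee := ee; have xV := idem_mulV mulP x.
have <- : e * (x + e) = x + e.
  apply: (idem_absorb mulP).
  rewrite brace_mulV (sinvM addP) (sinv_idem addP Aee).
  rewrite addA -(addA e) -brace_mulV -!brace_mul_idem //; last exact: idem_mul.
  by rewrite !mulA ee.
rewrite brace_distr (sinv_idem addP Aee) ee -addA Aee.
rewrite -{1}(isgKr addP (e * x)) -!addA (addA _ _ e) -brace_mulV.
have eV := idem_mulV mulP (e * x).
rewrite -(brace_mul_idem eV ee) (idemC mulP eV ee) !mulA ee brace_mulV.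
by rewrite addA (isgKr addP).
Qed.

Lemma brace_addl_idem e x : idempotents mul e -> e + x = e * x.
Proof.
move=> ee; have /brace_idem Aee := ee.
(* Distributing [e] over [y = (y + - y) + y] writes [e * y] as a sum starting with [e]. The case
   [y = - x], negated, gives [e + x + e = e + x]. *)
have eDe y : e + (y + e) = y + e.
  have yV : idempotents mul (y + - y) by apply/brace_idem/idem_mulV.
  rewrite (brace_addr_idem y ee).
  have := brace_distr e (y + - y) y.
  rewrite (isgKr addP) (sinv_idem addP Aee) (brace_mul_idem ee yV) => ->.
  by rewrite !addA Aee.
have := congr1 (sinv add) (eDe (- x)).
rewrite !(sinvM addP) (sinv_idem addP Aee) (sinvK addP) => <-.
by rewrite -addA eDe brace_addr_idem.
Qed.

(** The idempotent [- y + y] is central, so it absorbs [y + - y]. Taking [y] to be [x] and [- x]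
    puts each of the two idempotents below the other. *)
Lemma brace_addV x : x + - x = x * inv x.
Proof.
have Nidem y : idempotents mul (- y + y) by rewrite -brace_mulV; apply: idem_mulV.
have PE y : (- y + y) + (y + - y) = y + - y.
  rewrite addA (brace_addl_idem y (Nidem y)) -(brace_addr_idem y (Nidem y)).
  by rewrite addA (isgKr addP).
have xE := PE x; have := PE (- x).
rewrite (sinvK addP) -brace_mulV => <-; rewrite brace_mulV -[LHS]xE.
by apply: (idemC addP); apply/brace_idem; rewrite // -{1}(sinvK addP x).
Qed.

Lemma affine_of_braceE a b : affine_of_brace mul add a b = inv a * (a + b).
Proof.
rewrite /affine_of_brace brace_distr.
have -> : inv a * a = - inv a + inv a by rewrite -brace_mulV (sinvK mulP).
by rewrite (isgKl addP).
Qed.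

Lemma affine_of_brace_mul a b : a * affine_of_brace mul add a b = a + b.
Proof.
rewrite affine_of_braceE mulA -brace_addl_idem; last exact: idem_mulV.
by rewrite -brace_addV addA (isgKr addP).
Qed.

Lemma affine_of_brace_addr a b c :
  affine_of_brace mul add a (b + c) =
  affine_of_brace mul add a b + affine_of_brace mul add a c.
Proof. by rewrite /affine_of_brace brace_distr !addA. Qed.

(** The outer map is additive, so it commutes with negation; expanding leaves the idempotent
    [inv b + - inv b] in the middle, which the last summand absorbs. *)
Lemma affine_of_braceM a b c :
  affine_of_brace mul add (a * b) c =
  affine_of_brace mul add b (affine_of_brace mul add a c).
Proof.
rewrite {3}/affine_of_brace affine_of_brace_addr.
rewrite (sinv_morph addP _ (affine_of_brace_addr b)) /affine_of_brace.
rewrite (sinvM mulP) (sinvM addP) (sinvK addP) -addA (addA (inv b)) brace_addV.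
by rewrite (brace_addl_idem _ (idem_mulV mulP (inv b))) !mulA (isgKr mulP).
Qed.

Lemma affine_structure_of_brace :
  affine_structure mul (affine_of_brace mul add).
Proof.
split=> [||e a ee|e a ee].
- exact: affine_of_braceM.
(* Once each [a (a <+> b)] is read as [a + b], (A2) is additivity of the action. *)
- by move=> a b c; rewrite !affine_of_brace_mul affine_of_brace_addr.
- by rewrite affine_of_braceE (sinv_idem mulP ee) brace_addl_idem // mulA ee.
- by rewrite affine_of_braceE brace_addr_idem // mulA.
Qed.

End AffineOfBrace.

(** * From an affine structure to a weak left brace *)

Section BraceOfAffine.
Variables (S : Type) (mul dia : S -> S -> S).
Hypotheses (mulP : inverse_semigroup mul) (diaP : affine_structure mul dia).
Let add := brace_of_affine mul dia.
Local Infix "*" := mul.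
Local Infix "<+>" := dia (at level 40).
Local Infix "+" := add.
Local Notation inv := (sinv mul).

Let mulA := isgA mulP.

Lemma affineM a b c : (a * b) <+> c = b <+> (a <+> c).
Proof. by case: diaP. Qed.

Lemma affine_addr a b c : a <+> (b + c) = (a <+> b) + (a <+> c).
Proof. by case: diaP => _ + _ _; apply. Qed.

Lemma affine_idem e a : idempotents mul e -> e <+> a = e * a.
Proof. by case: diaP => _ _ + _; apply. Qed.

(** (A2) splits [x <+> (y + z)], and (A1) merges the two successive actions on [z] into that of
    [x + y]. *)
Lemma affine_addA : associative add.
Proof.
move=> x y z; rewrite {1}/add /brace_of_affine affine_addr.
by rewrite {1 2}/add /brace_of_affine mulA -affineM.
Qed.

Lemma affine_addl_idem e a : idempotents mul e -> e + a = e * a.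
Proof. by move=> ee; rewrite /add /brace_of_affine affine_idem // mulA ee. Qed.

Lemma affine_addr_idem e a : idempotents mul e -> a + e = e * a.
Proof.
move=> ee; rewrite /add /brace_of_affine; case: diaP => _ _ _ -> //.
by rewrite !mulA (idemC mulP (idem_mulV mulP a) ee) -!mulA (mulA a) (isgKr mulP).
Qed.

Lemma affine_mulE x y : x * y = x + (inv x <+> y).
Proof.
rewrite /add /brace_of_affine -affineM affine_idem; last exact: idem_mulVl.
by rewrite !mulA (isgKr mulP).
Qed.

(** The candidate for [- x]: it is the term added to [x] in [affine_mulE] at [y = inv x]. *)
Let neg x := inv x <+> inv x.

Lemma affine_addN x : x + neg x = x * inv x.
Proof. by rewrite -affine_mulE. Qed.

Lemma affine_mulVN x : x * inv x * neg x = neg x.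
Proof.
rewrite -affine_idem; last exact: idem_mulV.
by rewrite /neg -affineM mulA (isgKl mulP).
Qed.

Lemma affine_is_inverse x : is_inverse add x (neg x).
Proof.
have xV := idem_mulV mulP x.
split; first by rewrite affine_addN affine_addl_idem // (isgKr mulP).
by rewrite -affine_addA affine_addN affine_addr_idem // affine_mulVN.
Qed.

(** Adding [neg e] on the right of [e + e = e] yields [e = e * inv e]. *)
Lemma affine_add_idem e : idempotents add e -> idempotents mul e.
Proof.
rewrite /idempotents /= => ee; have := congr1 (add^~ (neg e)) ee.
rewrite -affine_addA affine_addN affine_addr_idem ?(isgKr mulP).
  by move->; exact: idem_mulV.
exact: idem_mulV.
Qed.

Lemma affine_add_isg : inverse_semigroup add.
Proof.
apply: inverse_semigroup_of_idemC.
- exact: affine_addA.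
- by move=> a; exists (neg a); apply: affine_is_inverse.
move=> e f /affine_add_idem ee /affine_add_idem ff.
by rewrite affine_addl_idem // affine_addr_idem.
Qed.

Lemma affine_sinv x : sinv add x = neg x.
Proof. exact: is_inverse_sinv affine_add_isg _ _ (affine_is_inverse x). Qed.

(** Both sides are multiplicative idempotents; each absorbs the other, since [neg x + x] fixes [x]
    and [x * inv x] fixes [neg x]. *)
Lemma affine_Nadd x : neg x + x = x * inv x.
Proof.
have xV := idem_mulV mulP x; have [xNx NxN] := affine_is_inverse x.
have hh : idempotents mul (neg x + x).
  by apply: affine_add_idem; rewrite /idempotents /= affine_addA NxN.
have hx : (neg x + x) * x = x by rewrite -affine_addr_idem // affine_addA.
have <- : x * inv x * (neg x + x) = neg x + x.
  rewrite -affine_addl_idem // affine_addA (affine_addl_idem (neg x) xV).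
  by rewrite affine_mulVN.
by rewrite (idemC mulP xV hh) mulA hx.
Qed.

Lemma weak_left_brace_of_affine : weak_left_brace add mul.
Proof.
split=> [|//|x y z|x]; first exact: affine_add_isg.
- have xV := idem_mulV mulP x.
  (* After expansion the sides differ only by the inner term [neg x + x = x * inv x], which is
     central and is absorbed by the leading [x]. *)
  rewrite affine_sinv !(affine_mulE x) affine_addr !affine_addA.
  rewrite -(affine_addA _ (neg x)) affine_Nadd.
  rewrite (affine_addr_idem _ xV) -(affine_addl_idem _ xV) affine_addA.
  by rewrite (affine_addl_idem x xV) (isgKr mulP).
- by rewrite affine_sinv affine_Nadd.
Qed.

End BraceOfAffine.

Theorem theorem3p20 (S : Type) (mul : S -> S -> S)
    (hS : inverse_semigroup mul) :
  (forall add : S -> S -> S, WB mul add -> forall a b : S,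
     affine_of_brace mul add a b = mul (sinv mul a) (add a b)) /\
  set_bij (WB mul) (AS mul) (affine_of_brace mul) /\
  set_bij (AS mul) (WB mul) (brace_of_affine mul) /\
  (forall add : S -> S -> S, WB mul add ->
     brace_of_affine mul (affine_of_brace mul add) = add) /\
  (forall dia : S -> S -> S, AS mul dia ->
     affine_of_brace mul (brace_of_affine mul dia) = dia).
Proof.
have AE add : WB mul add -> forall a b : S,
    affine_of_brace mul add a b = mul (sinv mul a) (add a b).
  exact: affine_of_braceE.
have AP add : WB mul add -> AS mul (affine_of_brace mul add).
  exact: affine_structure_of_brace.
have BP dia : AS mul dia -> WB mul (brace_of_affine mul dia).
  exact: weak_left_brace_of_affine.
have AK add : WB mul add -> brace_of_affine mul (affine_of_brace mul add) = add.
  by move=> addP; apply/funext => a; apply/funext => b;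
    apply: (affine_of_brace_mul addP).
have BK dia : AS mul dia -> affine_of_brace mul (brace_of_affine mul dia) = dia.
  move=> diaP; apply/funext => a; apply/funext => b.
  rewrite AE; last exact: BP.
  (* The idempotent [inv a * a] acts by multiplication, so (A1) merges it into the action of
     [a * inv a * a = a]. *)
  rewrite /brace_of_affine (isgA hS) -(affine_idem diaP); last exact: idem_mulVl.
  by rewrite -(affineM diaP) (isgA hS) (isgKr hS).
split; first exact: AE.
split; [split|split; [split|by split]].
- exact: AP.
- by move=> x y /set_mem xP /set_mem yP xy; rewrite -(AK x) // -(AK y) // xy.
- by move=> d dP; exists (brace_of_affine mul d); [exact: BP|exact: BK].
- exact: BP.
- by move=> x y /set_mem xP /set_mem yP xy; rewrite -(BK x) // -(BK y) // xy.
- by move=> d dP; exists (affine_of_brace mul d); [exact: AP|exact: AK].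
Qed.
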